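(* Let $A\in\mathbb{R}^{n_x\times n_x}$, $B\in\mathbb{R}^{n_x\times n_u}$ with $(A,B)$ controllable, and let $H=\begin{bmatrix}Q&S^\top\\ S&R\end{bmatrix}$ be real symmetric. Consider the two conditions: (I) there exist symmetric matrices $\Lambda_1,\Lambda_2$ with $H_{\Lambda_1}\succeq0$, $H_{\Lambda_2}\succeq0$ and $\Lambda_1-\Lambda_2\succ0$; (II) there exists a symmetric matrix $\Lambda$ with $H_\Lambda\succeq0$ and $Q_\Lambda-S_\Lambda^\top R_\Lambda^\dagger S_\Lambda\succ0$. If (I) or (II) holds, then the CGDARE has a stabilizing symmetric solution $P$ (that is, all eigenvalues of $A-BK$ lie strictly inside the unit circle, where $K=R_P^\dagger S_P$), the associated closed-loop system $x_+=(A-BK)x+BGv$, $v$ arbitrary, with $G=I-R_P^\dagger R_P$, is exponentially stable, and $BG=0$. Conversely, both (I) and (II) are necessary for exponential stability: if the CGDARE has a symmetric solution $P$ with $R_P\succeq0$ such that the associated closed-loop system $x_+=(A-BK)x+BGv$, $v$ arbitrary, is exponentially stable, then (I) and (II) both hold. Hence (I) and (II) imply each other.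
   Context: For symmetric $M\in\mathbb{R}^{n_x\times n_x}$ define $Q_M:=Q+A^\top MA-M$, $S_M:=S+B^\top MA$, $R_M:=R+B^\top MB$, $H_M:=\begin{bmatrix}Q_M&S_M^\top\\ S_M&R_M\end{bmatrix}$. $\dagger$ denotes the Moore-Penrose pseudo-inverse. The CGDARE (constrained generalized discrete algebraic Riccati equation) in the symmetric unknown $P$ is: $0=Q_P-S_P^\top K$, $K=R_P^\dagger S_P$, $\ker(R_P)\subseteq\ker(S_P^\top)$. The closed-loop system $x_+=(A-BK)x+BGv$ with $v$ arbitrary is exponentially stable if there are $c>0$ and $\rho\in(0,1)$ such that $\|x_k\|\le c\rho^k\|x_0\|$ for all $k\ge 0$, all $x_0$ and every sequence of vectors $(v_k)$. It describes the state evolution under all the optimal feedbacks $u=-Kx+Gv$ of the infinite-horizon linear-quadratic optimal control problem with dynamics $x_{k+1}=Ax_k+Bu_k$ and stage cost $\begin{bmatrix}x\\ u\end{bmatrix}^\top H\begin{bmatrix}x\\ u\end{bmatrix}$. *)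

(* Defs.v *)
From HB Require Import structures.
From mathcomp Require Import all_boot all_order all_algebra.
From mathcomp Require Import boolp classical_sets reals complex.
Set Implicit Arguments.
Unset Strict Implicit.
Unset Printing Implicit Defensive.
Import Order.TTheory GRing.Theory Num.Theory.
Local Open Scope ring_scope.
Local Open Scope complex_scope.
Local Open Scope classical_set_scope.

Definition is_mpinv (F : realType) (m n : nat)
    (M : 'M[F]_(m, n)) (X : 'M[F]_(n, m)) : Prop :=
  [/\ M *m X *m M = M, X *m M *m X = X,
      (M *m X)^T = M *m X & (X *m M)^T = X *m M].

(* The default value 0 is never used: see mpinvP. *)
Definition mpinv (F : realType) (m n : nat) (M : 'M[F]_(m, n)) : 'M[F]_(n, m) :=
  xget 0 [set X | is_mpinv M X].

Lemma is_mpinv_uniq (F : realType) (m n : nat) (M : 'M[F]_(m, n))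
    (X Y : 'M[F]_(n, m)) : is_mpinv M X -> is_mpinv M Y -> X = Y.
Proof.
move=> [X1 X2 X3 X4] [Y1 Y2 Y3 Y4].
have MXY : M *m X = M *m Y.
  rewrite -X3 -{1}Y1 -(mulmxA _ M X) trmx_mul X3 Y3 mulmxA.
  by rewrite X1.
have XMY : X *m M = Y *m M.
  rewrite -X4 -{1}Y1 -(mulmxA M Y M) mulmxA trmx_mul Y4 X4.
  by rewrite -!mulmxA (mulmxA M X M) X1.
by rewrite -X2 XMY -mulmxA MXY mulmxA Y2.
Qed.

Lemma gram_unitmx (F : realType) (m n : nat) (M : 'M[F]_(m, n)) :
  row_free M -> M *m M^T \in unitmx.
Proof.
move=> Mfree; rewrite -row_free_unit -kermx_eq0; apply/eqP/row_matrixP => i.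
rewrite row0; set u := row i _.
have uG : u *m (M *m M^T) = 0 by apply/sub_kermxP; exact: row_sub.
apply: (row_free_inj Mfree); rewrite mul0mx.
have : (u *m M) *m (u *m M)^T = 0.
  by rewrite trmx_mul mulmxA -(mulmxA u) uG mul0mx.
move: (u *m M) => w /matrixP/(_ 0 0); rewrite !mxE => w0.
have {w0} : \sum_j w 0 j ^+ 2 = 0.
  by rewrite -[RHS]w0; apply: eq_bigr => j _; rewrite mxE expr2.
move/psumr_eq0P => w0; apply/rowP => j; rewrite mxE; apply/eqP.
by rewrite -sqrf_eq0 w0 // => i0 _; exact: sqr_ge0.
Qed.

Lemma is_mpinv_exists (F : realType) (m n : nat) (M : 'M[F]_(m, n)) :
  exists X, is_mpinv M X.
Proof.
have : row_free (row_base M) by exact: row_base_free.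
have : row_free (col_base M)^T.
  by rewrite /row_free mxrank_tr; exact: col_base_full.
have := mulmx_base M.
move: (\rank M) (col_base M) (row_base M) => r C E <- Cfree Efree.
have Eu := gram_unitmx Efree; have := gram_unitmx Cfree; rewrite trmxK => Cu.
pose Ei := invmx (E *m E^T); pose Ci := invmx (C^T *m C).
have EX : E *m (E^T *m Ei *m (Ci *m C^T)) = Ci *m C^T.
  by rewrite !mulmxA mulmxV // mul1mx.
have XC : E^T *m Ei *m (Ci *m C^T) *m C = E^T *m Ei.
  by rewrite -!mulmxA mulVmx // mulmx1.
have EiT : Ei^T = Ei by rewrite trmx_inv trmx_mul trmxK.
have CiT : Ci^T = Ci by rewrite trmx_inv trmx_mul trmxK.
exists (E^T *m Ei *m (Ci *m C^T)); split.
- by rewrite -(mulmxA C) EX -!mulmxA (mulmxA C^T) (mulmxA Ci) mulVmx // mul1mx.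
- by rewrite (mulmxA _ C E) XC -(mulmxA _ E) EX !mulmxA.
- by rewrite -(mulmxA C) EX !trmx_mul trmxK CiT mulmxA.
- by rewrite (mulmxA _ C E) XC !trmx_mul trmxK EiT mulmxA.
Qed.

Lemma mpinvP (F : realType) (m n : nat) (M : 'M[F]_(m, n)) :
  is_mpinv M (mpinv M).
Proof.
have [X MX] := is_mpinv_exists M.
exact: (xgetPex 0 (ex_intro [set Y | is_mpinv M Y] X MX)).
Qed.

Definition quadform (F : realType) (n : nat) (M : 'M[F]_n) (x : 'cV[F]_n) : F :=
  (x^T *m M *m x) 0 0.

Definition psdmx (F : realType) (n : nat) (M : 'M[F]_n) : Prop :=
  M^T = M /\ forall x : 'cV[F]_n, 0 <= quadform M x.

Definition pdmx (F : realType) (n : nat) (M : 'M[F]_n) : Prop :=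
  M^T = M /\ forall x : 'cV[F]_n, x != 0 -> 0 < quadform M x.

(* The norm that mathcomp-analysis puts on matrices is the sup norm. *)
Definition enorm (F : realType) (n : nat) (x : 'cV[F]_n) : F :=
  Num.sqrt (\sum_(i < n) x i 0 ^+ 2).

Definition trajectory (F : realType) (nx nu : nat)
    (A : 'M[F]_nx) (B : 'M[F]_(nx, nu))
    (x : nat -> 'cV[F]_nx) (u : nat -> 'cV[F]_nu) : Prop :=
  forall k, x k.+1 = A *m x k + B *m u k.

(* Steering between arbitrary states, not merely to the origin; for singular A
   the latter is weaker. *)
Definition controllable (F : realType) (nx nu : nat)
    (A : 'M[F]_nx) (B : 'M[F]_(nx, nu)) : Prop :=
  forall x0 x1 : 'cV[F]_nx, exists (N : nat) (x : nat -> 'cV[F]_nx)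
    (u : nat -> 'cV[F]_nu), [/\ trajectory A B x u, x 0%N = x0 & x N = x1].

Definition exp_stable (F : realType) (nx nv : nat)
    (A : 'M[F]_nx) (B : 'M[F]_(nx, nv)) : Prop :=
  exists c rho : F, [/\ 0 < c, 0 < rho, rho < 1 &
    forall (x : nat -> 'cV[F]_nx) (v : nat -> 'cV[F]_nv), trajectory A B x v ->
      forall k, enorm (x k) <= c * rho ^+ k * enorm (x 0%N)].

Definition schur_stable (F : realType) (n : nat) (M : 'M[F]_n) : Prop :=
  forall z : F[i], eigenvalue (map_mx (real_complex F) M) z -> `|z| < 1.

Definition Qm (F : realType) (nx : nat) (A Q M : 'M[F]_nx) : 'M[F]_nx :=
  Q + A^T *m M *m A - M.

Definition Sm (F : realType) (nx nu : nat) (A : 'M[F]_nx) (B : 'M[F]_(nx, nu))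
    (S : 'M[F]_(nu, nx)) (M : 'M[F]_nx) : 'M[F]_(nu, nx) :=
  S + B^T *m M *m A.

Definition Rm (F : realType) (nx nu : nat) (B : 'M[F]_(nx, nu))
    (R : 'M[F]_nu) (M : 'M[F]_nx) : 'M[F]_nu :=
  R + B^T *m M *m B.

Definition Hm (F : realType) (nx nu : nat) (A : 'M[F]_nx) (B : 'M[F]_(nx, nu))
    (Q : 'M[F]_nx) (S : 'M[F]_(nu, nx)) (R : 'M[F]_nu) (M : 'M[F]_nx) :
    'M[F]_(nx + nu) :=
  block_mx (Qm A Q M) (Sm A B S M)^T (Sm A B S M) (Rm B R M).

Definition gainK (F : realType) (nx nu : nat) (A : 'M[F]_nx)
    (B : 'M[F]_(nx, nu)) (S : 'M[F]_(nu, nx)) (R : 'M[F]_nu) (P : 'M[F]_nx) :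
    'M[F]_(nu, nx) :=
  mpinv (Rm B R P) *m Sm A B S P.

Definition gainG (F : realType) (nx nu : nat) (B : 'M[F]_(nx, nu))
    (R : 'M[F]_nu) (P : 'M[F]_nx) : 'M[F]_nu :=
  1%:M - mpinv (Rm B R P) *m Rm B R P.

Definition cgdare (F : realType) (nx nu : nat) (A : 'M[F]_nx)
    (B : 'M[F]_(nx, nu)) (Q : 'M[F]_nx) (S : 'M[F]_(nu, nx)) (R : 'M[F]_nu)
    (P : 'M[F]_nx) : Prop :=
  0 = Qm A Q P - (Sm A B S P)^T *m gainK A B S R P /\
  (forall u : 'cV[F]_nu, Rm B R P *m u = 0 -> (Sm A B S P)^T *m u = 0).

Definition condI (F : realType) (nx nu : nat) (A : 'M[F]_nx)
    (B : 'M[F]_(nx, nu)) (Q : 'M[F]_nx) (S : 'M[F]_(nu, nx)) (R : 'M[F]_nu) :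
    Prop :=
  exists L1 L2 : 'M[F]_nx, [/\ L1^T = L1 /\ L2^T = L2,
    psdmx (Hm A B Q S R L1), psdmx (Hm A B Q S R L2) & pdmx (L1 - L2)].

Definition condII (F : realType) (nx nu : nat) (A : 'M[F]_nx)
    (B : 'M[F]_(nx, nu)) (Q : 'M[F]_nx) (S : 'M[F]_(nu, nx)) (R : 'M[F]_nu) :
    Prop :=
  exists L : 'M[F]_nx, [/\ L^T = L, psdmx (Hm A B Q S R L) &
    pdmx (Qm A Q L - (Sm A B S L)^T *m mpinv (Rm B R L) *m Sm A B S L)].

(* Main.v *)
Require Import Defs.
From HB Require Import structures.
From mathcomp Require Import all_boot all_order all_algebra ring lra zify.
From mathcomp Require Import boolp classical_sets reals complex.
From mathcomp Require Import topology normedtype derive sequences.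
Set Implicit Arguments.
Unset Strict Implicit.
Unset Printing Implicit Defensive.
Import Order.TTheory GRing.Theory Num.Theory.
Import numFieldTopology.Exports numFieldNormedType.Exports.
Local Open Scope ring_scope.

(* Write V_M(x) = x^T M x. The form of H_M at (x, u) is the stage cost plus
   V_M(Ax + Bu) - V_M(x), so every M with H_M >= 0 is a lower bound for the cost
   of steering x to 0; by controllability such M are bounded above. Above any
   such L choose P of maximal trace. A Riccati step keeps H_M >= 0 and increases
   M by the Schur complement of H_M, which therefore vanishes at P: this is the
   CGDARE.

   Let E = P - L. In closed-loop coordinates H_L >= 0 reads
   w^T R_P w + V_E(x) >= V_E((A - BK)x + Bw). If E > 0, then BG = 0 (x = 0,
   w in ker R_P), and V_E does not increase along the closed loop. If V_E were
   constant over enough steps, the resulting null vectors of the form would make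
   E x_N orthogonal to all reachable states, contradicting controllability; so
   V_E contracts over N steps. Condition (I) gives E > 0 directly, and (II)
   because V_E decreases strictly.

   Conversely, a Lyapunov matrix E of the closed loop gives L = P - dE, which
   for small d > 0 satisfies (II), and (I) together with P. *)

(** * Quadratic forms *)

(** The polarised, possibly rectangular form of [quadform], so that expansions become rewriting by
    bilinearity followed by [ring] or [lra]. *)
Definition bil (F : realType) (m n : nat) (M : 'M[F]_(m, n))
  (x : 'cV[F]_m) (y : 'cV[F]_n) : F := (x^T *m M *m y) 0 0.

Lemma quadform_bil (F : realType) n (M : 'M[F]_n) x : quadform M x = bil M x x.
Proof. by []. Qed.

Lemma bilDl (F : realType) m n (M : 'M[F]_(m, n)) x x' y :
  bil M (x + x') y = bil M x y + bil M x' y.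
Proof. by rewrite /bil linearD /= !mulmxDl mxE. Qed.

Lemma bilDr (F : realType) m n (M : 'M[F]_(m, n)) x y y' :
  bil M x (y + y') = bil M x y + bil M x y'.
Proof. by rewrite /bil mulmxDr mxE. Qed.

Lemma bilZl (F : realType) m n (M : 'M[F]_(m, n)) a x y :
  bil M (a *: x) y = a * bil M x y.
Proof. by rewrite /bil linearZ /= -!scalemxAl mxE. Qed.

Lemma bilZr (F : realType) m n (M : 'M[F]_(m, n)) a x y :
  bil M x (a *: y) = a * bil M x y.
Proof. by rewrite /bil -scalemxAr mxE. Qed.

Lemma bilNl (F : realType) m n (M : 'M[F]_(m, n)) x y :
  bil M (- x) y = - bil M x y.
Proof. by rewrite -scaleN1r bilZl mulN1r. Qed.

Lemma bilNr (F : realType) m n (M : 'M[F]_(m, n)) x y :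
  bil M x (- y) = - bil M x y.
Proof. by rewrite -scaleN1r bilZr mulN1r. Qed.

Lemma bil0r (F : realType) m n (M : 'M[F]_(m, n)) x : bil M x 0 = 0.
Proof. by rewrite /bil mulmx0 mxE. Qed.

Lemma bil0l (F : realType) m n (M : 'M[F]_(m, n)) y : bil M 0 y = 0.
Proof. by rewrite /bil trmx0 !mul0mx mxE. Qed.

Lemma bil0 (F : realType) m n x y : bil (0 : 'M[F]_(m, n)) x y = 0.
Proof. by rewrite /bil mulmx0 mul0mx mxE. Qed.

Lemma bilD (F : realType) m n (M N : 'M[F]_(m, n)) x y :
  bil (M + N) x y = bil M x y + bil N x y.
Proof. by rewrite /bil mulmxDr mulmxDl mxE. Qed.

Lemma bilZ (F : realType) m n a (M : 'M[F]_(m, n)) x y :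
  bil (a *: M) x y = a * bil M x y.
Proof. by rewrite /bil -scalemxAr -scalemxAl mxE. Qed.

Lemma bilN (F : realType) m n (M : 'M[F]_(m, n)) x y :
  bil (- M) x y = - bil M x y.
Proof. by rewrite -scaleN1r bilZ mulN1r. Qed.

Lemma bilB (F : realType) m n (M N : 'M[F]_(m, n)) x y :
  bil (M - N) x y = bil M x y - bil N x y.
Proof. by rewrite bilD bilN. Qed.

Lemma bil_tr (F : realType) m n (M : 'M[F]_(m, n)) x y :
  bil M^T y x = bil M x y.
Proof.
have e : y^T *m M^T *m x = (x^T *m M *m y)^T by rewrite !trmx_mul trmxK mulmxA.
by rewrite /bil e [LHS]mxE.
Qed.

Lemma bil_sym (F : realType) n (M : 'M[F]_n) x y :
  M^T = M -> bil M x y = bil M y x.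
Proof. by move=> Msym; rewrite -bil_tr Msym. Qed.

Lemma bil_mulr (F : realType) m n p (M : 'M[F]_(m, n)) (N : 'M[F]_(n, p)) x y :
  bil (M *m N) x y = bil M x (N *m y).
Proof. by rewrite /bil !mulmxA. Qed.

Lemma bil_mull (F : realType) m n p (N : 'M[F]_(m, p)) (M : 'M[F]_(m, n)) x y :
  bil (N^T *m M) x y = bil M (N *m x) y.
Proof. by rewrite /bil trmx_mul !mulmxA. Qed.

Lemma bil_congr (F : realType) m n p q (M : 'M[F]_(m, n)) (N : 'M[F]_(m, p))
    (P : 'M[F]_(n, q)) x y :
  bil (N^T *m M *m P) x y = bil M (N *m x) (P *m y).
Proof. by rewrite bil_mulr bil_mull. Qed.

Lemma bil_block (F : realType) nx nu (Q : 'M[F]_nx) (S : 'M[F]_(nu, nx))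
    (R : 'M[F]_nu) x u y v :
  bil (block_mx Q S^T S R) (col_mx x u) (col_mx y v) =
  bil Q x y + bil S v x + bil S u y + bil R u v.
Proof.
rewrite -(bil_tr S v) /bil tr_col_mx mul_row_block mul_row_col !mulmxDl.
by rewrite !mxE; ring.
Qed.

Lemma bil_delta (F : realType) m n (M : 'M[F]_(m, n)) i j :
  bil M (delta_mx i 0) (delta_mx j 0) = M i j.
Proof. by rewrite /bil trmx_delta -rowE -colE !mxE. Qed.

Lemma bil_delta1 (F : realType) n (x : 'cV[F]_n) i :
  bil 1%:M (delta_mx i 0) x = x i 0.
Proof. by rewrite /bil mulmx1 trmx_delta -rowE mxE. Qed.

Lemma quadform1 (F : realType) n (x : 'cV[F]_n) :
  quadform 1%:M x = \sum_i x i 0 ^+ 2.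
Proof.
by rewrite /quadform mulmx1 mxE; apply: eq_bigr => i _; rewrite mxE expr2.
Qed.

Lemma quadform1_ge0 (F : realType) n (x : 'cV[F]_n) : 0 <= quadform 1%:M x.
Proof. by rewrite quadform1; apply: sumr_ge0 => i _; exact: sqr_ge0. Qed.

Lemma quadform1_gt0 (F : realType) n (x : 'cV[F]_n) :
  x != 0 -> 0 < quadform 1%:M x.
Proof.
move=> x0; rewrite lt_def quadform1_ge0 andbT; apply: contra_neq x0.
rewrite quadform1 => /psumr_eq0P x0; apply/colP => i; rewrite mxE; apply/eqP.
by rewrite -sqrf_eq0 x0 // => j _; exact: sqr_ge0.
Qed.

Lemma pdmx_psd (F : realType) n (M : 'M[F]_n) : pdmx M -> psdmx M.
Proof.
move=> [Msym Mpd]; split=> // x; have [->|/Mpd/ltW//] := eqVneq x 0.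
by rewrite quadform_bil bil0r.
Qed.

Lemma psdmx_cauchy_schwarz (F : realType) n (M : 'M[F]_n) x y :
  psdmx M -> bil M x y ^+ 2 <= quadform M x * quadform M y.
Proof.
move=> [Msym Mpsd].
(* The form at [q(v) u - b v], with [q] the form of [M] and [b = bil M u v], factors this way; this
   suffices once [q(x)] or [q(y)] is positive. *)
have key u v : 0 <= quadform M v * (quadform M u * quadform M v - bil M u v ^+ 2).
  have := Mpsd (quadform M v *: u - bil M u v *: v).
  rewrite !quadform_bil !(bilDl, bilDr, bilNl, bilNr, bilZl, bilZr).
  rewrite (bil_sym v u Msym) => /le_trans; apply.
  by rewrite le_eqVlt; apply/predU1P; left; ring.
have := Mpsd x; rewrite le_eqVlt => /predU1P[x0|x0]; last first.
  by have := key y x; rewrite pmulr_rge0 // subr_ge0 (bil_sym y x Msym) mulrC.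
have := Mpsd y; rewrite le_eqVlt => /predU1P[y0|y0]; last first.
  by have := key x y; rewrite pmulr_rge0 // subr_ge0.
(* Both values vanish here, so the form at this vector is [-2 (bil M x y)^2]. *)
have := Mpsd (x - bil M x y *: y).
rewrite quadform_bil !(bilDl, bilDr, bilNl, bilNr, bilZl, bilZr).
by rewrite (bil_sym y x Msym) -!quadform_bil -x0 -y0; nra.
Qed.

Lemma psdmx_null (F : realType) n (M : 'M[F]_n) x :
  psdmx M -> quadform M x = 0 -> M *m x = 0.
Proof.
move=> Mpsd x0; apply/colP => i; rewrite [RHS]mxE.
have := psdmx_cauchy_schwarz (delta_mx i 0) x Mpsd.
rewrite x0 mulr0 real_exprn_even_le0 ?num_real //= => /eqP.
by rewrite -bil_delta1 -bil_mulr mul1mx.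
Qed.

(** Cauchy-Schwarz for [R] between each row of [X] and [w]; the summand 1 in the constant keeps it
    positive. *)
Lemma psdmx_mulmx_bound (F : realType) m n (R : 'M[F]_n) (X : 'M[F]_(m, n)) :
  psdmx R -> exists2 C, 0 < C &
    forall w, quadform 1%:M (X *m R *m w) <= C * quadform R w.
Proof.
move=> Rpsd; have [Rsym Rge0] := Rpsd.
have c0 : 0 <= \sum_i quadform R (X^T *m delta_mx i 0) by exact: sumr_ge0.
exists (1 + \sum_i quadform R (X^T *m delta_mx i 0)); first by lra.
move=> w; rewrite mulrDl mul1r quadform1 mulr_suml.
apply: le_trans (_ : _ <= \sum_i quadform R (X^T *m delta_mx i 0) * quadform R w) _.
  apply: ler_sum => i _; apply: le_trans (psdmx_cauchy_schwarz _ _ Rpsd).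
  by rewrite -bil_mull trmxK -bil_delta1 -bil_mulr mul1mx.
by rewrite lerDr.
Qed.

(** [psdmx_mulmx_bound] with [X] the inverse of [M], in place of a least eigenvalue. *)
Lemma pdmx_coercive (F : realType) n (M : 'M[F]_n) :
  pdmx M -> exists2 C, 0 < C & forall x, quadform 1%:M x <= C * quadform M x.
Proof.
move=> Mpd; have [Msym Mgt0] := Mpd.
have Munit : M \in unitmx.
  rewrite -row_free_unit -kermx_eq0; apply/eqP/row_matrixP => i; rewrite row0.
  have uM : row i (kermx M) *m M = 0 by apply/sub_kermxP; exact: row_sub.
  apply: trmx_inj; rewrite trmx0; apply/eqP; apply: contraT => /Mgt0.
  by rewrite /quadform trmxK uM mul0mx mxE ltxx.
have [C C0 HC] := psdmx_mulmx_bound (invmx M) (pdmx_psd Mpd).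
by exists C => // x; have := HC x; rewrite mulVmx // mul1mx.
Qed.

Lemma quadform_le_norm (F : realType) n (M : 'M[F]_n) :
  exists2 C, 0 < C & forall x, quadform M x <= C * quadform 1%:M x.
Proof.
have one_psd : psdmx (1%:M : 'M[F]_n).
  by split; [exact: trmx1 | exact: quadform1_ge0].
have [C C0 HC] := psdmx_mulmx_bound M one_psd.
exists (1 + C) => [|x]; first by lra.
have := psdmx_cauchy_schwarz x (M *m x) one_psd.
rewrite -bil_mulr mul1mx -quadform_bil => cs.
have := HC x; rewrite mulmx1 => bnd.
have n0 := quadform1_ge0 x; have Mn0 := quadform1_ge0 (M *m x).
suff : quadform M x ^+ 2 <= ((1 + C) * quadform 1%:M x) ^+ 2.
  have [q0|q0] := leP 0 (quadform M x); last by move=> _; nra.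
  by rewrite ler_sqr // nnegrE mulr_ge0 // addr_ge0 // ltW.
apply: le_trans cs _.
apply: le_trans (ler_wpM2l n0 bnd) _.
rewrite mulrCA -expr2 exprMn; apply: ler_wpM2r; first exact: sqr_ge0.
by nra.
Qed.

(** * The matrix inequality H_M >= 0 *)

(** [(0, u)] is a null vector of the form, hence in the kernel of the block matrix. This gives the
    kernel inclusion of the CGDARE wherever the matrix inequality holds. *)
Lemma psdmx_block_null (F : realType) nx nu (Q : 'M[F]_nx) (S : 'M[F]_(nu, nx))
    (R : 'M[F]_nu) (u : 'cV[F]_nu) :
  psdmx (block_mx Q S^T S R) -> R *m u = 0 -> S^T *m u = 0.
Proof.
move=> Hpsd Ru.
have H0u : quadform (block_mx Q S^T S R) (col_mx 0 u) = 0.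
  rewrite quadform_bil bil_block !(bil0l, bil0r) !add0r.
  by rewrite /bil -mulmxA Ru mulmx0 mxE.
have /(congr1 usubmx) := psdmx_null Hpsd H0u.
by rewrite mul_block_col mulmx0 add0r col_mxKu linear0.
Qed.

Lemma psdmx_block_dr (F : realType) nx nu (Q : 'M[F]_nx) (S : 'M[F]_(nu, nx))
    (R : 'M[F]_nu) : psdmx (block_mx Q S^T S R) -> psdmx R.
Proof.
move=> [Hsym Hge0]; split.
  by move: Hsym; rewrite tr_block_mx => /eq_block_mx[].
move=> u; have := Hge0 (col_mx 0 u).
by rewrite !quadform_bil bil_block !(bil0l, bil0r) !add0r.
Qed.

Lemma trmx_mpinv (F : realType) m n (M : 'M[F]_(m, n)) :
  (mpinv M)^T = mpinv M^T.
Proof.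
have [M1 M2 M3 M4] := mpinvP M; apply: is_mpinv_uniq (mpinvP _).
by split; rewrite -!trmx_mul ?mulmxA ?M1 ?M2 ?M3 ?M4.
Qed.

(** The columns of [1 - mpinv R *m R] lie in the kernel of [R], so [S] kills them. *)
Lemma mulmx_mpinv_absorb (F : realType) m n p (S : 'M[F]_(p, n))
    (R : 'M[F]_(m, n)) :
  (forall u : 'cV[F]_n, R *m u = 0 -> S *m u = 0) -> S *m (mpinv R *m R) = S.
Proof.
move=> kerRS; have [RXR _ _ _] := mpinvP R.
apply/eqP; rewrite eq_sym -subr_eq0 -[X in X - _]mulmx1 -mulmxBr; apply/eqP.
have kerj j : R *m ((1%:M - mpinv R *m R) *m delta_mx j (0 : 'I_1)) = 0.
  by rewrite mulmxA mulmxBr mulmx1 mulmxA RXR subrr mul0mx.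
apply/matrixP => i j; have /matrixP/(_ i 0) := kerRS _ (kerj j).
by rewrite mulmxA -colE [LHS]mxE [RHS]mxE => ->; rewrite mxE.
Qed.

Lemma mulmx_gain (F : realType) nx nu (S : 'M[F]_(nu, nx)) (R : 'M[F]_nu) :
  R^T = R -> (forall u : 'cV[F]_nu, R *m u = 0 -> S^T *m u = 0) ->
  R *m (mpinv R *m S) = S.
Proof.
move=> Rsym /mulmx_mpinv_absorb/(congr1 trmx).
by rewrite !trmx_mul trmxK trmx_mpinv Rsym mulmxA.
Qed.

(** Completing the square with a possibly singular [R]: the kernel inclusion gives [R K = S] for
    [K = mpinv R *m S], which makes the cross terms cancel. *)
Lemma block_completion (F : realType) nx nu (Q : 'M[F]_nx)
    (S : 'M[F]_(nu, nx)) (R : 'M[F]_nu) x w :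
  R^T = R -> (forall u : 'cV[F]_nu, R *m u = 0 -> S^T *m u = 0) ->
  quadform (block_mx Q S^T S R) (col_mx x (w - mpinv R *m S *m x)) =
  quadform (Q - S^T *m (mpinv R *m S)) x + quadform R w.
Proof.
move=> Rsym kerRS; have RK := mulmx_gain Rsym kerRS.
move: (mpinv R *m S) RK => K RK.
rewrite !quadform_bil bil_block bilB bil_mulr bil_tr -RK !bil_mulr.
rewrite !(bilDl, bilDr, bilNl, bilNr) (bil_sym (K *m x) w Rsym).
by ring.
Qed.

Lemma quadform_Hm (F : realType) nx nu (A : 'M[F]_nx) (B : 'M[F]_(nx, nu))
    (Q : 'M[F]_nx) (S : 'M[F]_(nu, nx)) (R : 'M[F]_nu) (M : 'M[F]_nx) x u :
  M^T = M ->
  quadform (Hm A B Q S R M) (col_mx x u) =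
  quadform (block_mx Q S^T S R) (col_mx x u) +
  quadform M (A *m x + B *m u) - quadform M x.
Proof.
move=> Msym; rewrite !quadform_bil !bil_block /Qm /Sm /Rm.
rewrite !(bilB, bilD) !bil_congr !(bilDl, bilDr).
by rewrite (bil_sym (A *m x) (B *m u) Msym); ring.
Qed.

Lemma trmx_Hm (F : realType) nx nu (A : 'M[F]_nx) (B : 'M[F]_(nx, nu))
    (Q : 'M[F]_nx) (S : 'M[F]_(nu, nx)) (R : 'M[F]_nu) (M : 'M[F]_nx) :
  (block_mx Q S^T S R)^T = block_mx Q S^T S R -> M^T = M ->
  (Hm A B Q S R M)^T = Hm A B Q S R M.
Proof.
rewrite !tr_block_mx => /eq_block_mx[Qsym _ _ Rsym] Msym.
rewrite trmxK; congr block_mx.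
  by rewrite /Qm linearB linearD /= !trmx_mul trmxK Qsym Msym mulmxA.
by rewrite /Rm linearD /= !trmx_mul trmxK Rsym Msym mulmxA.
Qed.

(** Read as a dissipation inequality, the condition is a family of scalar inequalities affine in
    [M]; both the summation of costs and the compactness argument rely on this form. *)
Lemma psdmx_HmP (F : realType) nx nu (A : 'M[F]_nx) (B : 'M[F]_(nx, nu))
    (Q : 'M[F]_nx) (S : 'M[F]_(nu, nx)) (R : 'M[F]_nu) (M : 'M[F]_nx) :
  (block_mx Q S^T S R)^T = block_mx Q S^T S R -> M^T = M ->
  (psdmx (Hm A B Q S R M) <-> forall x u,
    quadform M x <= quadform (block_mx Q S^T S R) (col_mx x u) +
      quadform M (A *m x + B *m u)).
Proof.
move=> Hsym Msym; split=> [[_ Hge0] x u|Hle].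
  by have := Hge0 (col_mx x u); rewrite quadform_Hm // subr_ge0.
split=> [|y]; first exact: trmx_Hm.
by rewrite -[y]vsubmxK quadform_Hm // subr_ge0.
Qed.

(** The generalised Schur complement of [Rm] in [Hm]. The first CGDARE equation says that it
    vanishes, and [M + residual M] is the Riccati operator at [M]. *)
Definition residual (F : realType) nx nu (A : 'M[F]_nx) (B : 'M[F]_(nx, nu))
    (Q : 'M[F]_nx) (S : 'M[F]_(nu, nx)) (R : 'M[F]_nu) (M : 'M[F]_nx) :=
  Qm A Q M - (Sm A B S M)^T *m gainK A B S R M.

Lemma quadform_Hm_gain (F : realType) nx nu (A : 'M[F]_nx)
    (B : 'M[F]_(nx, nu)) (Q : 'M[F]_nx) (S : 'M[F]_(nu, nx)) (R : 'M[F]_nu)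
    (M : 'M[F]_nx) x w :
  (Rm B R M)^T = Rm B R M ->
  (forall u : 'cV[F]_nu, Rm B R M *m u = 0 -> (Sm A B S M)^T *m u = 0) ->
  quadform (Hm A B Q S R M) (col_mx x (w - gainK A B S R M *m x)) =
  quadform (residual A B Q S R M) x + quadform (Rm B R M) w.
Proof. exact: block_completion. Qed.

Lemma psdmx_residual (F : realType) nx nu (A : 'M[F]_nx)
    (B : 'M[F]_(nx, nu)) (Q : 'M[F]_nx) (S : 'M[F]_(nu, nx)) (R : 'M[F]_nu)
    (M : 'M[F]_nx) :
  psdmx (Hm A B Q S R M) -> psdmx (residual A B Q S R M).
Proof.
move=> Hpsd; have [Hsym Hge0] := Hpsd; have [Rsym _] := psdmx_block_dr Hpsd.
have kerRS := fun u => @psdmx_block_null F _ _ _ _ _ u Hpsd.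
split=> [|x]; last first.
  have := Hge0 (col_mx x (0 - gainK A B S R M *m x)).
  by rewrite quadform_Hm_gain // (quadform_bil _ 0) bil0l addr0.
rewrite /residual /gainK linearB /= !trmx_mul trmxK trmx_mpinv Rsym mulmxA.
by have := Hsym; rewrite tr_block_mx => /eq_block_mx[-> _ _ _].
Qed.

(** With [D] the residual of [M], the step adds [D(A x + B u) - D(x)] to the form, whose completed
    square contains [D(x)]. What remains is [D(A x + B u)] plus a value of [Rm], both
    nonnegative. *)
Lemma psdmx_Hm_improve (F : realType) nx nu (A : 'M[F]_nx)
    (B : 'M[F]_(nx, nu)) (Q : 'M[F]_nx) (S : 'M[F]_(nu, nx)) (R : 'M[F]_nu)
    (M : 'M[F]_nx) :
  (block_mx Q S^T S R)^T = block_mx Q S^T S R -> M^T = M ->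
  psdmx (Hm A B Q S R M) ->
  psdmx (Hm A B Q S R (M + residual A B Q S R M)).
Proof.
move=> Hsym Msym Hpsd; have [Rsym Rge0] := psdmx_block_dr Hpsd.
have kerRS := fun u => @psdmx_block_null F _ _ _ _ _ u Hpsd.
have [resym rege0] := psdmx_residual Hpsd.
apply/psdmx_HmP => // [|x u]; first by rewrite linearD /= Msym resym.
have := quadform_Hm_gain Q x (u + gainK A B S R M *m x) Rsym kerRS.
rewrite addrK quadform_Hm // !(quadform_bil (M + _)) !(bilD M) -!quadform_bil.
have := rege0 (A *m x + B *m u); have := Rge0 (u + gainK A B S R M *m x).
by lra.
Qed.

Lemma trajectory_cost_ge (F : realType) nx nu (A : 'M[F]_nx)
    (B : 'M[F]_(nx, nu)) (Q : 'M[F]_nx) (S : 'M[F]_(nu, nx)) (R : 'M[F]_nu)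
    (M : 'M[F]_nx) x u N :
  (block_mx Q S^T S R)^T = block_mx Q S^T S R -> M^T = M ->
  psdmx (Hm A B Q S R M) -> trajectory A B x u ->
  quadform M (x 0%N) <=
  \sum_(k < N) quadform (block_mx Q S^T S R) (col_mx (x k) (u k)) +
  quadform M (x N).
Proof.
move=> Hsym Msym Hpsd traj; elim: N => [|N IH]; first by rewrite big_ord0 add0r.
rewrite big_ord_recr /= -addrA (le_trans IH) // lerD2l traj.
by move/(psdmx_HmP A B Hsym Msym) : Hpsd; apply.
Qed.

(** Steering [x] to 0 makes the terminal term vanish, and the cost of that one trajectory does not
    depend on [M]. *)
Lemma lmi_bounded (F : realType) nx nu (A : 'M[F]_nx) (B : 'M[F]_(nx, nu))
    (Q : 'M[F]_nx) (S : 'M[F]_(nu, nx)) (R : 'M[F]_nu) :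
  controllable A B -> (block_mx Q S^T S R)^T = block_mx Q S^T S R ->
  exists c : 'cV_nx -> F, forall M x, M^T = M ->
    psdmx (Hm A B Q S R M) -> quadform M x <= c x.
Proof.
move=> ctrl Hsym.
suff /choice[c Hc] : forall x : 'cV[F]_nx, exists c, forall M, M^T = M ->
    psdmx (Hm A B Q S R M) -> quadform M x <= c.
  by exists c => M x; exact: Hc.
move=> y; have [N [x [u [traj <- xN]]]] := ctrl y 0.
exists (\sum_(k < N) quadform (block_mx Q S^T S R) (col_mx (x k) (u k))).
move=> M Msym /(trajectory_cost_ge N Hsym Msym)/(_ traj).
by rewrite xN (quadform_bil M 0) bil0l addr0.
Qed.

(** * Maximal solutions *)

Lemma scalar_vec_mx_continuous (F : realType) n (f : 'M[F]_n -> F) :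
  scalar f -> continuous (fun v : 'rV[F]_(n * n) => f (vec_mx v)).
Proof.
move=> flin.
pose g (j : 'I_(n * n)) := f (vec_mx (delta_mx 0 j)).
have f0 : f 0 = 0.
  by have := flin (-1) 0 0; rewrite scaler0 addr0 mulN1r addNr.
have fsum : (fun v : 'rV[F]_(n * n) => f (vec_mx v)) =
    (fun v => \sum_j v 0 j * g j).
  apply/funext => v; rewrite {1}[v]row_sum_delta linear_sum /=.
  elim/big_rec2: _ => [//|j y1 y2 _ IH].
  by rewrite linearZ /= flin IH.
rewrite fsum; apply: continuous_big => [|j _ v].
  exact: add_continuous.
apply: (@continuousM _ _ (fun v : 'rV[F]_(n * n) => v 0 j) (fun=> g j)).
  exact: coord_continuous.
exact: cst_continuous.
Qed.

(** The feasible set is an intersection of closed half-spaces inside a box, hence compact for any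
    index type [I], and the extreme value theorem applies. Matrices are flattened because
    [rV_compact] speaks of row vectors. *)
Lemma scalar_constraints_max (F : realType) n (I : Type)
    (f : I -> 'M[F]_n -> F) (c : I -> F) (g : 'M[F]_n -> F) (b : 'I_n -> 'I_n -> F)
    (M0 : 'M[F]_n) :
  (forall i, scalar (f i)) -> scalar g ->
  (forall M, (forall i, c i <= f i M) -> forall j k, `|M j k| <= b j k) ->
  (forall i, c i <= f i M0) ->
  exists2 P, (forall i, c i <= f i P) &
    forall M, (forall i, c i <= f i M) -> g M <= g P.
Proof.
move=> flin glin bnd M0feas.
pose K := [set v : 'rV[F]_(n * n) | forall i, c i <= f i (vec_mx v)]%classic.
have Kclosed : closed K.
  have -> : K =
      (\bigcap_i ((fun v => f i (vec_mx v)) @^-1` [set x | c i <= x]))%classic.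
    by apply/seteqP; split=> v /= Kv i => [_|]; exact: Kv.
  apply: closed_bigI => i _; apply: preimage_closed; last exact: closed_ge.
  by move=> v _; exact: scalar_vec_mx_continuous.
pose bb (j : 'I_(n * n)) :=
  let p := enum_val (cast_ord (esym (mxvec_cast n n)) j) in b p.1 p.2.
have Kcompact : compact K.
  have boxc := rV_compact (fun j => @segment_compact F (- bb j) (bb j)).
  apply: (subclosed_compact Kclosed boxc).
  move=> v Kv j; rewrite /= in_itv /= -ler_norml.
  have := bnd _ Kv.
  case/mxvec_indexP: j => j k /(_ j k).
  by rewrite mxE /bb /mxvec_index cast_ordK enum_rankK.
have Kn0 : (K !=set0)%classic by exists (mxvec M0) => i /=; rewrite mxvecK.
have [|P KP Pmax] := @compact_EVT_max _ F (fun v => g (vec_mx v)) K Kn0 Kcompact.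
  by apply: continuous_subspaceT => v; exact: scalar_vec_mx_continuous.
exists (vec_mx P); first by move: KP; rewrite inE.
move=> M Mfeas; rewrite -[M]mxvecK; apply: Pmax.
by rewrite inE /K /= mxvecK.
Qed.

(** Polarisation: bounds on the form at finitely many vectors become bounds on the entries. *)
Lemma symmx_entry (F : realType) n (M : 'M[F]_n) i j : M^T = M ->
  M i j *+ 2 = quadform M (delta_mx i 0 + delta_mx j 0) -
    quadform M (delta_mx i 0) - quadform M (delta_mx j 0).
Proof.
move=> Msym; rewrite !quadform_bil !(bilDl, bilDr) (bil_sym (delta_mx j 0) _ Msym).
by rewrite (bil_delta _ i j) mulr2n; ring.
Qed.

Lemma scalar_quadform (F : realType) n (x : 'cV[F]_n) :
  scalar (fun M : 'M[F]_n => quadform M x).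
Proof. by move=> a M N; rewrite quadform_bil bilD bilZ. Qed.

Lemma lmi_trace_max (F : realType) nx nu (A : 'M[F]_nx) (B : 'M[F]_(nx, nu))
    (Q : 'M[F]_nx) (S : 'M[F]_(nu, nx)) (R : 'M[F]_nu) (L : 'M[F]_nx) :
  controllable A B -> (block_mx Q S^T S R)^T = block_mx Q S^T S R ->
  L^T = L -> psdmx (Hm A B Q S R L) ->
  exists P, [/\ P^T = P, psdmx (Hm A B Q S R P),
    forall x, quadform L x <= quadform P x &
    forall M, M^T = M -> psdmx (Hm A B Q S R M) ->
      (forall x, quadform L x <= quadform M x) -> \tr M <= \tr P].
Proof.
move=> ctrl Hsym Lsym Lpsd.
have [c Hc] := lmi_bounded ctrl Hsym.
(* Three families of constraints linear in [M]: symmetry, where [(i, j)] and [(j, i)] give opposite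
   inequalities, then the matrix inequality, then [L <= M]. *)
pose T := ('I_nx * 'I_nx + 'cV[F]_nx * 'cV[F]_nu + 'cV[F]_nx)%type.
pose f (t : T) (M : 'M[F]_nx) : F := match t with
  | inl (inl (i, j)) => M i j - M j i
  | inl (inr (x, u)) => quadform M (A *m x + B *m u) - quadform M x
  | inr x => quadform M x end.
pose d (t : T) : F := match t with
  | inl (inl _) => 0
  | inl (inr (x, u)) => - quadform (block_mx Q S^T S R) (col_mx x u)
  | inr x => quadform L x end.
have feasP M : (forall t, d t <= f t M) <->
    [/\ M^T = M, psdmx (Hm A B Q S R M) & forall x, quadform L x <= quadform M x].
  split=> [dfM|[Msym /(psdmx_HmP A B Hsym Msym) MH LM]].
    have Msym : M^T = M.
      apply/matrixP => i j; rewrite mxE; apply/eqP; rewrite eq_le.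
      have /= := dfM (inl (inl (i, j))); have /= := dfM (inl (inl (j, i))).
      by rewrite !subr_ge0 => -> ->.
    split=> //; last by move=> x; exact: (dfM (inr x)).
    apply/psdmx_HmP => // x u.
    by have /= := dfM (inl (inr (x, u))); lra.
  case=> [[[i j]|[x u]]|x] /=; last exact: LM.
    by rewrite -{1}Msym mxE subrr.
  by have := MH x u; lra.
have [||||P /feasP[Psym PH LP] Pmax] :=
  @scalar_constraints_max F nx T f d (fun M => \tr M)
    (fun i j => let b x := `|c x| + `|quadform L x| in
      b (delta_mx i 0 + delta_mx j 0) + b (delta_mx i 0) + b (delta_mx j 0)) L.
- case=> [[[i j]|[x u]]|x] a M N /=; rewrite ?mxE; first by ring.
    by rewrite !scalar_quadform; ring.
  exact: scalar_quadform.
- by move=> a M N; rewrite mxtraceD mxtraceZ.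
- move=> M /feasP[Msym MH LM] i j /=.
  have bnd x : `|quadform M x| <= `|c x| + `|quadform L x|.
    rewrite ler_norml; have := Hc M x Msym MH; have := LM x.
    have := ler_norm (c x); have := ler_norm (- quadform L x); rewrite normrN.
    have := normr_ge0 (c x); have := normr_ge0 (quadform L x).
    by move=> *; apply/andP; split; lra.
  have := symmx_entry i j Msym; rewrite mulr2n.
  have := bnd (delta_mx i 0 + delta_mx j 0).
  have := bnd (delta_mx i 0); have := bnd (delta_mx j 0).
  rewrite !ler_norml => /andP[? ?] /andP[? ?] /andP[? ?] ?.
  by apply/andP; split; lra.
- by apply/feasP; split.
by exists P; split=> // M Msym MH LM; apply: Pmax; apply/feasP; split.
Qed.

(** A nonnegative diagonal with nonpositive sum vanishes; Cauchy-Schwarz then kills the other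
    entries. *)
Lemma psdmx_tr0 (F : realType) n (M : 'M[F]_n) : psdmx M -> \tr M <= 0 -> M = 0.
Proof.
move=> Mpsd trM; have [Msym Mge0] := Mpsd.
have diag0 i : M i i = 0.
  have: \sum_i M i i = 0.
    apply/eqP; rewrite eq_le trM /=; apply: sumr_ge0 => j _.
    by rewrite -(bil_delta M) -quadform_bil.
  move/psumr_eq0P => -> // j _; rewrite -(bil_delta M) -quadform_bil.
  exact: Mge0.
apply/matrixP => i j; rewrite [RHS]mxE.
have := psdmx_cauchy_schwarz (delta_mx i 0) (delta_mx j 0) Mpsd.
rewrite !quadform_bil !bil_delta !diag0 mul0r.
by rewrite real_exprn_even_le0 ?num_real //= => /eqP.
Qed.

(* One Riccati step [M |-> M + residual M] stays in the LMI set and increases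
   [M], so a trace-maximal point of that set must have zero residual. *)
Lemma cgdare_above (F : realType) nx nu (A : 'M[F]_nx) (B : 'M[F]_(nx, nu))
    (Q : 'M[F]_nx) (S : 'M[F]_(nu, nx)) (R : 'M[F]_nu) (L : 'M[F]_nx) :
  controllable A B -> (block_mx Q S^T S R)^T = block_mx Q S^T S R ->
  L^T = L -> psdmx (Hm A B Q S R L) ->
  exists P, [/\ P^T = P, cgdare A B Q S R P, psdmx (Hm A B Q S R P) &
    forall x, quadform L x <= quadform P x].
Proof.
move=> ctrl Hsym Lsym Lpsd.
have [P [Psym PH LP Pmax]] := lmi_trace_max ctrl Hsym Lsym Lpsd.
exists P; split=> //.
have respsd := psdmx_residual PH; have [resym rege0] := respsd.
split=> [|u]; last exact: psdmx_block_null PH.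
apply/esym/(psdmx_tr0 respsd); rewrite -(lerD2l (\tr P)) addr0 -mxtraceD.
apply: Pmax; first by rewrite linearD /= Psym resym.
  exact: psdmx_Hm_improve.
by move=> x; rewrite (quadform_bil (P + _)) (bilD P) -!quadform_bil ler_wpDr.
Qed.

(** * Lyapunov stability *)

Lemma expr_small (F : realType) (rho e : F) : 0 <= rho -> rho < 1 -> 0 < e ->
  exists k, rho ^+ k < e.
Proof.
move=> rho0 rho1 e0; have rhon : `|rho| < 1 by rewrite ger0_norm.
have /cvgrPdist_lt/(_ e e0)[k _ /(_ k (leqnn k))] := cvg_expr rhon.
by rewrite sub0r normrN ger0_norm ?exprn_ge0 // => ?; exists k.
Qed.

Lemma sqr_enorm (F : realType) n (x : 'cV[F]_n) :
  enorm x ^+ 2 = quadform 1%:M x.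
Proof.
by rewrite quadform1 sqr_sqrtr //; apply: sumr_ge0 => i _; exact: sqr_ge0.
Qed.

Lemma enorm_ge0 (F : realType) n (x : 'cV[F]_n) : 0 <= enorm x.
Proof. exact: sqrtr_ge0. Qed.

Lemma ler_enorm_entry (F : realType) n (x : 'cV[F]_n) i : `|x i 0| <= enorm x.
Proof.
rewrite -ler_sqr ?nnegrE ?enorm_ge0 // sqr_enorm quadform1 real_normK ?num_real //.
by rewrite (bigD1 i) //= lerDl; apply: sumr_ge0 => j _; exact: sqr_ge0.
Qed.

Lemma exp_stable_expr (F : realType) n m (A : 'M[F]_n) (B : 'M[F]_(n, m)) :
  exp_stable A B -> exists c rho : F, [/\ 0 < c, 0 < rho, rho < 1 &
    forall x k, enorm (A ^+ k *m x) <= c * rho ^+ k * enorm x].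
Proof.
move=> [c [rho [c0 rho0 rho1 decay]]]; exists c, rho; split=> // x k.
have := decay (fun k => A ^+ k *m x) (fun=> 0); rewrite /= expr0 mul1mx.
by apply=> j; rewrite mulmx0 addr0 exprS -mulmxE -mulmxA.
Qed.

Lemma exp_stable_input0 (F : realType) n m (A : 'M[F]_n) (B : 'M[F]_(n, m)) :
  exp_stable A B -> B = 0.
Proof.
move=> [c [rho [c0 rho0 rho1 decay]]].
suff Bv (v : 'cV_m) : B *m v = 0.
  apply/matrixP => i j; have /matrixP/(_ i 0) := Bv (delta_mx j 0).
  by rewrite -colE !mxE.
(* From the initial state 0 the bound forces all states to be 0, but the constant input [v] makes
   the first one [B v]. *)
pose x := nat_rect (fun=> 'cV[F]_n) 0 (fun _ xk => A *m xk + B *m v).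
have x0 : enorm (x 0%N) = 0.
  by apply/eqP; rewrite -sqrf_eq0 sqr_enorm quadform_bil bil0l.
have := decay x (fun=> v) (fun=> erefl) 1%N; rewrite x0 mulr0 /= mulmx0 add0r.
move=> Bv0; apply/colP => i; rewrite [RHS]mxE; apply/eqP.
by rewrite -normr_le0 (le_trans (ler_enorm_entry _ i)).
Qed.

Lemma lyapunov_exp_stable (F : realType) n m (A E : 'M[F]_n) :
  pdmx E -> pdmx (E - A^T *m E *m A) -> exp_stable A (0 : 'M[F]_(n, m)).
Proof.
move=> Epd Dpd.
have [C1 C1gt0 E_coer] := pdmx_coercive Epd.
have [C2 C2gt0 D_coer] := pdmx_coercive Dpd.
have [C3 C3gt0 E_le] := quadform_le_norm E.
have [_ Ege0] := pdmx_psd Epd.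
(* [E <= C3 C2 (E - A^T E A)], so each step loses at least the fraction [1 / (1 + C3 C2)] of [E];
   the added 1 keeps [r] positive. *)
pose r := 1 - (1 + C3 * C2)^-1.
have K1 : 1 < 1 + C3 * C2 by rewrite ltrDl mulr_gt0.
have r01 : 0 < r /\ r < 1.
  by rewrite subr_gt0 invf_lt1 ?gtrBl ?invr_gt0 //; lra.
have [r0 r1] := r01.
have contr x : quadform E (A *m x) <= r * quadform E x.
  have : quadform E x <= (1 + C3 * C2) * (quadform E x - quadform E (A *m x)).
    rewrite [X in _ <= _ * (_ - X)](_ : _ = quadform (A^T *m E *m A) x); last first.
      by rewrite !quadform_bil bil_congr.
    have -> : quadform E x - quadform (A^T *m E *m A) x =
        quadform (E - A^T *m E *m A) x.
      by rewrite !quadform_bil bilB.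
    apply: le_trans (E_le x) _.
    apply: le_trans (_ : C3 * (C2 * quadform (E - A^T *m E *m A) x) <= _).
      by rewrite ler_pM2l.
    rewrite mulrA ler_wpM2r //; last by lra.
    by have [_] := pdmx_psd Dpd; apply.
  rewrite -ler_pdivrMl ?(lt_trans ltr01) // /r => ?; lra.
exists (Num.sqrt (C1 * C3)), (Num.sqrt r); split.
- by rewrite sqrtr_gt0 mulr_gt0.
- by rewrite sqrtr_gt0.
- by rewrite -[ltRHS]sqrtr1 ltr_sqrt.
move=> x v traj k.
have decay : quadform E (x k) <= r ^+ k * quadform E (x 0%N).
  elim: k => [|k IH]; first by rewrite expr0 mul1r.
  rewrite traj mul0mx addr0 exprS -mulrA.
  by apply: le_trans (contr _) _; rewrite ler_pM2l.
rewrite -ler_sqr ?nnegrE ?enorm_ge0 ?mulr_ge0 ?exprn_ge0 ?enorm_ge0 ?sqrtr_ge0 //.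
have [r_ge0 C_ge0] : 0 <= r /\ 0 <= C1 * C3 by rewrite !ltW ?mulr_gt0.
rewrite !exprMn -exprM mulnC exprM !sqr_enorm !sqr_sqrtr //.
apply: le_trans (E_coer _) _; rewrite -!mulrA ler_pM2l //.
apply: le_trans decay _; by rewrite mulrCA ler_wpM2l ?exprn_ge0.
Qed.

(* The sum of [E] along [N] steps of the orbit telescopes, so a strict
   decrease of [E] over [N] steps becomes a strict decrease over one step. *)
Lemma lyapunov_of_contraction (F : realType) n (A E : 'M[F]_n) N :
  pdmx E -> (forall x, x != 0 -> quadform E (A ^+ N *m x) < quadform E x) ->
  exists G, pdmx G /\ pdmx (G - A^T *m G *m A).
Proof.
move=> Epd contr; have [Esym Egt0] := Epd; have [_ Ege0] := pdmx_psd Epd.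
pose G := \sum_(k < N) (A ^+ k)^T *m E *m A ^+ k.
have GE x : quadform G x = \sum_(k < N) quadform E (A ^+ k *m x).
  rewrite /quadform /G mulmx_sumr mulmx_suml summxE; apply: eq_bigr => k _.
  by rewrite trmx_mul !mulmxA.
have Gsym : G^T = G.
  rewrite /G linear_sum; apply: eq_bigr => k _ /=.
  by rewrite !trmx_mul trmxK Esym mulmxA.
exists G; split; split=> //.
- move=> x x0; have := contr x x0; rewrite GE.
  (* For [N = 0] the contraction would read [E(x) < E(x)]; otherwise the summand [k = 0] already
     makes the sum positive. *)
  case: N @G GE Gsym {contr} => [|N] G _ _; first by rewrite expr0 mul1mx ltxx.
  rewrite big_ord_recl /= expr0 mul1mx => _.
  by rewrite ltr_pwDl ?Egt0 // sumr_ge0.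
- by rewrite linearB /= !trmx_mul trmxK Gsym mulmxA.
- move=> x x0.
  have -> : quadform (G - A^T *m G *m A) x = quadform G x - quadform G (A *m x).
    by rewrite !quadform_bil bilB bil_congr.
  rewrite !GE -sumrB.
  have -> : \sum_(k < N) (quadform E (A ^+ k *m x) - quadform E (A ^+ k *m (A *m x)))
      = quadform E x - quadform E (A ^+ N *m x).
    rewrite -(big_mkord xpredT (fun k =>
      quadform E (A ^+ k *m x) - quadform E (A ^+ k *m (A *m x)))).
    have := telescope_sumr (fun k => quadform E (A ^+ k *m x)) (leq0n N).
    rewrite expr0 mul1mx => T; rewrite -[RHS]opprB -T -sumrN.
    by apply: eq_bigr => k _; rewrite opprB mulmxA exprSr -mulmxE.
  by rewrite subr_gt0 contr.
Qed.

(** A left eigenvector satisfies [v A^k = z^k v], while the entries of [A^k] decay geometrically; if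
    [|z| >= 1], each entry of [v] is bounded by a null sequence. *)
Lemma exp_stable_schur (F : realType) n m (A : 'M[F]_n) (B : 'M[F]_(n, m)) :
  exp_stable A B -> schur_stable A.
Proof.
move=> /exp_stable_expr[c [rho [c0 rho0 rho1 decay]]] z.
move=> /eigenvalueP[v vA v0].
have vAk k : v *m map_mx (real_complex F) (A ^+ k) = z ^+ k *: v.
  elim: k => [|k IH]; first by rewrite !expr0 map_mx1 mulmx1 scale1r.
  by rewrite !exprSr map_mxM mulmxA IH -scalemxAl vA scalerA.
have Aent k i j : `|(A ^+ k) i j| <= c * rho ^+ k.
  have := decay (delta_mx j 0) k; rewrite -colE.
  have -> : enorm (delta_mx j 0 : 'cV[F]_n) = 1.
    apply/eqP; rewrite -sqrp_eq1 ?enorm_ge0 // sqr_enorm quadform_bil bil_delta.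
    by rewrite mxE eqxx.
  rewrite mulr1; apply: le_trans; apply: le_trans (ler_enorm_entry _ i).
  by rewrite mxE.
apply: contraT => zge1; have {zge1} z1 : 1 <= `|z|.
  by rewrite real_leNgt ?normr_real ?real1.
(* The moduli of the entries of [v], taken back to [F], where the decay estimate lives. *)
pose a i := complex.Re `|v 0 i|.
have aE i : (a i)%:C%C = `|v 0 i|.
  by rewrite /a normc_def.
have vbound j k : a j <= (\sum_i a i) * (c * rho ^+ k).
  rewrite -lecR aE rmorphM rmorph_sum /=.
  apply: le_trans (_ : `|z ^+ k * v 0 j| <= _).
    by rewrite normrM normrX ler_peMl // exprn_ege1.
  have /matrixP/(_ 0 j) := vAk k; rewrite !mxE => <-.
  apply: le_trans (ler_norm_sum _ _ _) _; rewrite mulr_suml; apply: ler_sum => i _.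
  rewrite aE normrM ler_wpM2l // mxE.
  by rewrite normc_def /= expr0n addr0 sqrtr_sqr lecR Aent.
have a_ge0 i : 0 <= a i by rewrite /a normc_def sqrtr_ge0.
case/negP: v0; apply/eqP/rowP => j; rewrite mxE; apply/eqP.
rewrite -normr_eq0 -aE; suff -> : a j = 0 by [].
apply/eqP; rewrite eq_le a_ge0 andbT leNgt; apply/negP => aj.
have s0 : 0 < (\sum_i a i) * c.
  by rewrite mulr_gt0 // (bigD1 j) //= ltr_pwDl // sumr_ge0.
have [k] := expr_small (ltW rho0) rho1 (divr_gt0 aj s0).
by rewrite ltr_pdivlMr // mulrC -mulrA ltNge vbound.
Qed.

(** * The closed loop *)

Lemma feedback_step (F : realType) nx nu (A : 'M[F]_nx) (B : 'M[F]_(nx, nu))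
    (K : 'M[F]_(nu, nx)) (x : 'cV[F]_nx) w :
  A *m x + B *m (w - K *m x) = (A - B *m K) *m x + B *m w.
Proof. by rewrite mulmxBr mulmxBl -mulmxA addrA addrAC. Qed.

Lemma quadform_Hm_00 (F : realType) nx nu (A : 'M[F]_nx) (B : 'M[F]_(nx, nu))
    (R : 'M[F]_nu) (M : 'M[F]_nx) x w : M^T = M ->
  quadform (Hm A B 0 0 R M) (col_mx x w) =
  quadform R w + quadform M (A *m x + B *m w) - quadform M x.
Proof.
move=> Msym; rewrite quadform_Hm // [in X in X + _]quadform_bil bil_block !bil0.
by rewrite !add0r.
Qed.

(* With [u = w - K x] the stage cost becomes [w^T R_P w] up to a telescoping
   term, so [H_L] turns into the LMI of [L - P] for the closed loop. *)
Lemma quadform_Hm_closed_loop (F : realType) nx nu (A : 'M[F]_nx)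
    (B : 'M[F]_(nx, nu)) (Q : 'M[F]_nx) (S : 'M[F]_(nu, nx)) (R : 'M[F]_nu)
    (P L : 'M[F]_nx) x w :
  P^T = P -> L^T = L -> (Rm B R P)^T = Rm B R P -> cgdare A B Q S R P ->
  quadform (Hm A B Q S R L) (col_mx x (w - gainK A B S R P *m x)) =
  quadform (Hm (A - B *m gainK A B S R P) B 0 0 (Rm B R P) (L - P)) (col_mx x w).
Proof.
move=> Psym Lsym Rsym [res0 kerRS].
have := quadform_Hm_gain Q x w Rsym kerRS.
rewrite (_ : residual _ _ _ _ _ _ = 0); last by rewrite /residual -res0.
rewrite quadform_Hm_00; last by rewrite linearB /= Lsym Psym.
rewrite !quadform_Hm // feedback_step !(quadform_bil 0, quadform_bil (L - P)).
rewrite !bil0 !bilB -!quadform_bil.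
by lra.
Qed.

Lemma psdmx_Hm_closed_loop (F : realType) nx nu (A : 'M[F]_nx)
    (B : 'M[F]_(nx, nu)) (Q : 'M[F]_nx) (S : 'M[F]_(nu, nx)) (R : 'M[F]_nu)
    (P L : 'M[F]_nx) :
  (block_mx Q S^T S R)^T = block_mx Q S^T S R ->
  P^T = P -> L^T = L -> (Rm B R P)^T = Rm B R P -> cgdare A B Q S R P ->
  (psdmx (Hm A B Q S R L) <->
   psdmx (Hm (A - B *m gainK A B S R P) B 0 0 (Rm B R P) (L - P))).
Proof.
move=> Hsym Psym Lsym Rsym care.
have Lcl := quadform_Hm_closed_loop _ _ Psym Lsym Rsym care.
split=> [] [_ Hge0]; split=> [|y].
- apply: trmx_Hm.
    by rewrite tr_block_mx !trmx0 Rsym.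
  by rewrite linearB /= Lsym Psym.
- by rewrite -[y]vsubmxK -Lcl.
- exact: trmx_Hm.
- rewrite -[y]vsubmxK -[dsubmx y](addrK (gainK A B S R P *m usubmx y)) Lcl.
  exact: Hge0.
Qed.

(** * Contraction through controllability *)

(** The basis vectors may be reached at different times [m], so [N] is only a common upper bound. *)
Lemma controllable_reach (F : realType) nx nu (A : 'M[F]_nx)
    (B : 'M[F]_(nx, nu)) : controllable A B ->
  exists N, forall i, exists m x u, [/\ (m <= N)%N, trajectory A B x u,
    x 0%N = 0 & x m = delta_mx i 0].
Proof.
move=> ctrl.
have /choice[m Hm] i := ctrl 0 (delta_mx i 0).
exists (\max_i m i) => i; have [x [u [traj x0 xm]]] := Hm i.
by exists (m i), x, u; split=> //; exact: leq_bigmax.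
Qed.

Lemma controllable_feedback (F : realType) nx nu (A : 'M[F]_nx)
    (B : 'M[F]_(nx, nu)) K : controllable A B -> controllable (A - B *m K) B.
Proof.
move=> ctrl x0 x1; have [N [x [u [traj <- <-]]]] := ctrl x0 x1.
exists N, x, (fun k => u k + K *m x k); split=> // k.
by rewrite -feedback_step addrK.
Qed.

Lemma lyapunov_contraction (F : realType) nx nu (A : 'M[F]_nx)
    (B : 'M[F]_(nx, nu)) (R : 'M[F]_nu) (E : 'M[F]_nx) :
  controllable A B -> pdmx E -> psdmx (Hm A B 0 0 R (- E)) ->
  exists N, forall x, x != 0 -> quadform E (A ^+ N *m x) < quadform E x.
Proof.
move=> ctrl Epd Hpsd; have [Esym Egt0] := Epd; have [_ Ege0] := pdmx_psd Epd.
have [_ Hge0] := Hpsd.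
have drop x : quadform (Hm A B 0 0 R (- E)) (col_mx x 0) =
    quadform E x - quadform E (A *m x).
  rewrite quadform_Hm_00 ?linearN /= ?Esym // mulmx0 addr0.
  by rewrite !quadform_bil bil0l !bilN; ring.
have mono x : quadform E (A *m x) <= quadform E x.
  by rewrite -subr_ge0 -drop.
(* Equality makes [(x, 0)] a null vector of the whole matrix; its two blocks are the two
   equations. *)
have null x : quadform E (A *m x) = quadform E x ->
    E *m x = A^T *m (E *m (A *m x)) /\ B^T *m (E *m (A *m x)) = 0.
  move=> Ex; have := psdmx_null Hpsd (_ : quadform _ (col_mx x 0) = 0).
  rewrite drop Ex subrr => /(_ erefl).
  rewrite mul_block_col !mulmx0 !addr0 -[0 in RHS](col_mx0 F nx nu 1).
  case/eq_col_mx=> H1 H2; split.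
    apply/eqP; rewrite -subr_eq0; apply/eqP; rewrite -[RHS]H1 /Qm mulmxN mulNmx.
    by rewrite add0r opprK mulmxDl mulNmx addrC -!mulmxA.
  apply/eqP; rewrite -oppr_eq0; apply/eqP; rewrite -[RHS]H2 /Sm add0r.
  by rewrite mulmxN !mulNmx -!mulmxA.
have [N reach] := controllable_reach ctrl; exists N => x x0.
have orbit k : A ^+ k.+1 *m x = A *m (A ^+ k *m x) by rewrite exprS -mulmxE -mulmxA.
have orbit_mono k m : (k <= m)%N ->
    quadform E (A ^+ m *m x) <= quadform E (A ^+ k *m x).
  elim: m => [|m IH]; first by rewrite leqn0 => /eqP ->.
  rewrite leq_eqVlt ltnS => /predU1P[-> //|/IH]; apply: le_trans.
  by rewrite orbit.
have := orbit_mono 0%N N (leq0n N); rewrite expr0 mul1mx le_eqVlt.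
case/predU1P=> // Econst.
(* A nonincreasing sequence with equal ends is constant, so [null] applies at each of the [N]
   steps. *)
have step k : (k < N)%N ->
    E *m (A ^+ k *m x) = A^T *m (E *m (A ^+ k.+1 *m x)) /\
    B^T *m (E *m (A ^+ k.+1 *m x)) = 0.
  move=> kN; rewrite orbit; apply: null; apply/eqP; rewrite eq_le mono /= -orbit.
  apply: le_trans (orbit_mono _ _ kN); rewrite Econst.
  by have := orbit_mono 0%N k (leq0n k); rewrite expr0 mul1mx.
(* [E (A^N x)] is orthogonal to everything reachable from 0 within N steps. *)
have orth m y u j : (m <= N)%N -> trajectory A B y u -> y 0%N = 0 -> (j <= m)%N ->
    bil E (A ^+ (N - m + j) *m x) (y j) = 0.
  move=> mN traj y0; elim: j => [|j IH] jm; first by rewrite y0 bil0r.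
  have [|EA EB] := step (N - m + j)%N; first by lia.
  rewrite traj bilDr addnS (bil_sym _ (A *m y j) Esym) (bil_sym _ (B *m u j) Esym).
  (* The equations of [step] move [A] and [B] across the pairing: its value at [j + 1] is that at
     [j], and the input contributes nothing. *)
  have -> : bil E (A *m y j) (A ^+ (N - m + j).+1 *m x) =
      bil E (y j) (A ^+ (N - m + j) *m x).
    by rewrite /bil trmx_mul -!mulmxA -EA.
  have -> : bil E (B *m u j) (A ^+ (N - m + j).+1 *m x) = 0.
    by rewrite /bil trmx_mul -!mulmxA EB mulmx0 mxE.
  by rewrite addr0 bil_sym // IH // ltnW.
have EN0 : E *m (A ^+ N *m x) = 0.
  apply/colP => i; rewrite [RHS]mxE -bil_delta1 -bil_mulr mul1mx.
  (* The shift [N - m] in [orth] aligns the end of every trajectory with time [N]. *)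
  have [m [y [u [mN traj y0 <-]]]] := reach i.
  have := orth m y u m mN traj y0 (leqnn m); rewrite subnK //.
  by rewrite bil_sym.
have := Egt0 x x0; rewrite -Econst /quadform -mulmxA EN0 mulmx0 mxE.
by rewrite ltxx.
Qed.

Lemma mulmx_gainG (F : realType) nx nu (B : 'M[F]_(nx, nu)) (R : 'M[F]_nu)
    (P : 'M[F]_nx) : Rm B R P *m gainG B R P = 0.
Proof.
have [RXR _ _ _] := mpinvP (Rm B R P).
by rewrite /gainG mulmxBr mulmx1 mulmxA RXR subrr.
Qed.

(** On the kernel of [Rm B R P] the form at [(0, w)] is [-E(B w)], which forces [B w = 0]; the
    columns of [gainG] lie in that kernel. *)
Lemma mulmx_gainG_eq0 (F : realType) nx nu (A : 'M[F]_nx) (B : 'M[F]_(nx, nu))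
    (R : 'M[F]_nu) (P E : 'M[F]_nx) :
  pdmx E -> psdmx (Hm A B 0 0 (Rm B R P) (- E)) -> B *m gainG B R P = 0.
Proof.
move=> Epd Hpsd; have [Esym Egt0] := Epd; have [Rsym _] := psdmx_block_dr Hpsd.
have [_ Hge0] := Hpsd.
have key (w : 'cV[F]_nu) : Rm B R P *m w = 0 -> B *m w = 0.
  move=> Rw; apply/eqP; apply: contraT => /Egt0; rewrite ltNge => /negP[].
  have := Hge0 (col_mx 0 w).
  rewrite quadform_Hm_00 ?linearN /= ?Esym // mulmx0 add0r.
  have -> : quadform (Rm B R P) w = 0 by rewrite /quadform -mulmxA Rw mulmx0 mxE.
  by rewrite !quadform_bil bil0r subr0 bilN add0r oppr_ge0.
apply/matrixP => i j.
have /key/matrixP/(_ i 0) :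
    Rm B R P *m (gainG B R P *m (delta_mx j 0 : 'cV[F]_nu)) = 0.
  by rewrite mulmxA mulmx_gainG mul0mx.
by rewrite mulmxA -colE [LHS]mxE [X in _ = X -> _]mxE => ->; rewrite mxE.
Qed.

(** [P - L] is only known to contract strictly over [N] steps; [lyapunov_of_contraction] trades it
    for a matrix that decreases at every step. *)
Lemma cgdare_stabilizing (F : realType) nx nu (A : 'M[F]_nx)
    (B : 'M[F]_(nx, nu)) (Q : 'M[F]_nx) (S : 'M[F]_(nu, nx)) (R : 'M[F]_nu)
    (P L : 'M[F]_nx) :
  controllable A B -> (block_mx Q S^T S R)^T = block_mx Q S^T S R ->
  P^T = P -> L^T = L -> cgdare A B Q S R P -> psdmx (Hm A B Q S R P) ->
  psdmx (Hm A B Q S R L) -> pdmx (P - L) ->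
  [/\ schur_stable (A - B *m gainK A B S R P),
      exp_stable (A - B *m gainK A B S R P) (B *m gainG B R P) &
      B *m gainG B R P = 0].
Proof.
move=> ctrl Hsym Psym Lsym care PH LH PLpd.
have [Rsym _] := psdmx_block_dr PH.
have := LH => /(psdmx_Hm_closed_loop Hsym Psym Lsym Rsym care).
rewrite -(opprB P L) => Hcl; have BG := mulmx_gainG_eq0 PLpd Hcl.
have [N contr] :=
  lyapunov_contraction (controllable_feedback _ ctrl) PLpd Hcl.
have [G [Gpd Dpd]] := lyapunov_of_contraction PLpd contr.
have expst : exp_stable (A - B *m gainK A B S R P) (B *m gainG B R P).
  by rewrite BG; exact: lyapunov_exp_stable Gpd Dpd.
by split=> //; exact: exp_stable_schur expst.
Qed.

(** The form of [H_L] at [(x, -K x)] is computed twice: as the drop of [P - L] over one closed-loop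
    step, and as the residual of [L] plus a nonnegative term. The drop is thus positive, and
    [P - L >= 0] at the next state. *)
Lemma condII_gap (F : realType) nx nu (A : 'M[F]_nx)
    (B : 'M[F]_(nx, nu)) (Q : 'M[F]_nx) (S : 'M[F]_(nu, nx)) (R : 'M[F]_nu)
    (P L : 'M[F]_nx) :
  (block_mx Q S^T S R)^T = block_mx Q S^T S R ->
  P^T = P -> L^T = L -> cgdare A B Q S R P -> psdmx (Hm A B Q S R P) ->
  psdmx (Hm A B Q S R L) -> pdmx (residual A B Q S R L) ->
  (forall x, quadform L x <= quadform P x) -> pdmx (P - L).
Proof.
move=> Hsym Psym Lsym care PH LH [_ resgt0] LP.
have [RPsym _] := psdmx_block_dr PH; have [RLsym RLge0] := psdmx_block_dr LH.
split=> [|x x0]; first by rewrite linearB /= Psym Lsym.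
pose K := gainK A B S R P; pose KL := gainK A B S R L.
have := quadform_Hm_closed_loop x 0 Psym Lsym RPsym care.
rewrite add0r.
have := quadform_Hm_gain Q x (KL *m x - K *m x) RLsym
  (fun u => @psdmx_block_null F _ _ _ _ _ u LH).
rewrite -/KL addrAC subrr add0r => -> cl.
have := resgt0 x x0; have := RLge0 (KL *m x - K *m x).
have := LP ((A - B *m K) *m x).
rewrite quadform_Hm_00 ?linearB /= ?Lsym ?Psym // mulmx0 addr0 in cl.
move: cl; rewrite !(quadform_bil (L - P), quadform_bil (P - L)) !bilB.
rewrite (quadform_bil _ 0) bil0l -!quadform_bil -/K.
by lra.
Qed.

(** * Necessity of the two conditions *)

Lemma bil_amgm (F : realType) n (E : 'M[F]_n) t x y : psdmx E -> 0 < t ->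
  2 * bil E x y <= t * quadform E x + t^-1 * quadform E y.
Proof.
move=> [Esym Ege0] t0.
rewrite -(ler_pM2l t0) mulrDr (mulrA t t^-1) divff ?gt_eqF // mul1r.
have := Ege0 (t *: x - y).
rewrite quadform_bil !(bilDl, bilDr, bilNl, bilNr, bilZl, bilZr) (bil_sym y x Esym).
by rewrite -!quadform_bil; lra.
Qed.

(** Once [c rho^k < 1], the Euclidean norm itself contracts over [k] steps. *)
Lemma exp_stable_lyapunov (F : realType) n m (A : 'M[F]_n) (B : 'M[F]_(n, m)) :
  exp_stable A B -> exists E, pdmx E /\ pdmx (E - A^T *m E *m A).
Proof.
move=> /exp_stable_expr[c [rho [c0 rho0 rho1 decay]]].
have cV0 : 0 < c^-1 by rewrite invr_gt0.
have [k krho] := expr_small (ltW rho0) rho1 cV0.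
apply: (@lyapunov_of_contraction F n A 1%:M k).
  by split; [exact: trmx1 | exact: quadform1_gt0].
move=> x /quadform1_gt0; rewrite -!sqr_enorm => x0.
have nx0 : 0 < enorm x by rewrite lt_def enorm_ge0 andbT -sqrf_eq0 gt_eqF.
rewrite ltr_sqr ?nnegrE ?enorm_ge0 // (le_lt_trans (decay x k)) //.
by rewrite -[ltRHS]mul1r ltr_pM2r // mulrC -ltr_pdivlMr // div1r.
Qed.

(** For [L = P - d E] the form of [H_L] in closed-loop coordinates is [R_P(w) + d D(x) - 2 d E(Acl
    x, B w) - d E(B w)]. The cross term costs at most half of [d D(x)] and a multiple of [d E(B w)],
    which [R_P] absorbs for small [d]. *)
Lemma exp_stable_conds (F : realType) nx nu (A : 'M[F]_nx)
    (B : 'M[F]_(nx, nu)) (Q : 'M[F]_nx) (S : 'M[F]_(nu, nx)) (R : 'M[F]_nu)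
    (P : 'M[F]_nx) :
  (block_mx Q S^T S R)^T = block_mx Q S^T S R -> P^T = P ->
  cgdare A B Q S R P -> psdmx (Rm B R P) ->
  exp_stable (A - B *m gainK A B S R P) (B *m gainG B R P) ->
  condI A B Q S R /\ condII A B Q S R.
Proof.
move=> Hsym Psym care Rpsd expst; have [Rsym Rge0] := Rpsd.
have BG := exp_stable_input0 expst.
have [E [Epd Dpd]] := exp_stable_lyapunov expst.
have Epsd := pdmx_psd Epd; have [Esym Ege0] := Epsd.
have [_ Dge0] := pdmx_psd Dpd; have [_ Dgt0] := Dpd.
have cl := quadform_Hm_closed_loop _ _ Psym _ Rsym care.
move: (A - B *m _) cl Dpd Dge0 Dgt0 {expst} => Acl cl Dpd Dge0 Dgt0.
set D := E - Acl^T *m E *m Acl in Dpd Dge0 Dgt0.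
have DE x : quadform D x = quadform E x - quadform E (Acl *m x).
  by rewrite !quadform_bil bilB bil_congr.
have [C1 C1gt0 D_coer] := pdmx_coercive Dpd.
have [C2 C2gt0 E_le] := quadform_le_norm E.
have [C3 C3gt0 RB] := psdmx_mulmx_bound (B *m mpinv (Rm B R P)) Rpsd.
have {RB} EB w : quadform E (B *m w) <= C2 * C3 * quadform (Rm B R P) w.
  apply: le_trans (E_le _) _; rewrite -mulrA ler_pM2l //.
  have := RB w; rewrite -(mulmxA B).
  (* [B G = 0] says that [B] equals [B *m mpinv (Rm B R P) *m Rm B R P], so [R_P] controls [B w]. *)
  have /eqP := BG; rewrite /gainG mulmxBr mulmx1 subr_eq0 => /eqP <-.
  by [].
have ED x : quadform E (Acl *m x) <= C2 * C1 * quadform D x.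
  have := Dge0 x; rewrite {1}DE subr_ge0 => /le_trans; apply.
  by apply: le_trans (E_le _) _; rewrite -mulrA ler_pM2l.
(* Chosen so that [t E(Acl x) <= D(x) / 2]. *)
pose t := (2 * (C2 * C1))^-1.
have CC1 : 0 < C2 * C1 by rewrite mulr_gt0.
have CC3 : 0 < C2 * C3 by rewrite mulr_gt0.
have t0 : 0 < t by rewrite invr_gt0 mulr_gt0.
(* Chosen so that [d (1 + 1/t) E(B w) <= R_P(w)]: the 1 pays for [E(B w)] itself, [1/t] for its
   share of the cross term. *)
pose d := ((1 + t^-1) * (C2 * C3))^-1.
have T1 : 0 < 1 + t^-1 by rewrite addr_gt0 ?ltr01 // invr_gt0.
have d0 : 0 < d by rewrite invr_gt0 mulr_gt0.
pose L := P - d *: E.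
have Lsym : L^T = L by rewrite /L linearB linearZ /= Psym Esym.
have PL : P - L = d *: E by rewrite /L opprB addrC subrK.
(* This one bound yields both [H_L >= 0] and the strict positivity of the residual of [L]. *)
have bnd x w : d / 2 * quadform D x <=
    quadform (Hm A B Q S R L) (col_mx x (w - gainK A B S R P *m x)).
  have LPsym : (L - P)^T = L - P by rewrite [LHS]linearB /= Lsym Psym.
  rewrite cl // quadform_Hm_00 //.
  rewrite -(opprB P L) PL.
  rewrite !(quadform_bil (- _)) !bilN !bilZ bilDl !bilDr (bil_sym (B *m w) _ Esym).
  rewrite -!quadform_bil.
  have amgm := bil_amgm (Acl *m x) (B *m w) Epsd t0.
  have tE : t * quadform E (Acl *m x) <= quadform D x / 2.
    rewrite /t ler_pdivrMl ?mulr_gt0 //.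
    by have := ED x; lra.
  have dE : d * ((1 + t^-1) * quadform E (B *m w)) <= quadform (Rm B R P) w.
    rewrite /d ler_pdivrMl; last by rewrite mulr_gt0.
    by rewrite -mulrA ler_pM2l.
  have : d * (quadform D x / 2) <= d * (quadform D x - 2 * bil E (Acl *m x) (B *m w)
      + t^-1 * quadform E (B *m w)).
    by rewrite ler_wpM2l ?(ltW d0) //; lra.
  have := DE x.
  by move: dE; nra.
have LH : psdmx (Hm A B Q S R L).
  split=> [|y]; first exact: trmx_Hm.
  rewrite -[y]vsubmxK -[dsubmx y](addrK (gainK A B S R P *m usubmx y)).
  by apply: le_trans (bnd _ _); rewrite mulr_ge0 // divr_ge0 // ltW.
have PH : psdmx (Hm A B Q S R P).
  split=> [|y]; first exact: trmx_Hm.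
  rewrite -[y]vsubmxK -[dsubmx y](addrK (gainK A B S R P *m usubmx y)).
  have [res0 kerRS] := care.
  rewrite quadform_Hm_gain // (_ : residual _ _ _ _ _ _ = 0) ?quadform_bil ?bil0.
    by rewrite add0r -quadform_bil Rge0.
  by rewrite /residual -res0.
split; [exists P, L; split=> // | exists L; split=> //].
  rewrite PL; split=> [|x x0]; first by rewrite linearZ /= Esym.
  by rewrite quadform_bil bilZ mulr_gt0 //; have [_] := Epd; apply.
rewrite -mulmxA -/(residual A B Q S R L); have [ressym _] := psdmx_residual LH.
split=> // x x0.
have [RLsym _] := psdmx_block_dr LH.
(* The residual of [L] is the form of [H_L] at the input [-K_L x], which is then rewritten in the
   closed-loop coordinates of [P]. *)
have := quadform_Hm_gain Q x 0 RLsym (fun u => @psdmx_block_null F _ _ _ _ _ u LH).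
rewrite (quadform_bil _ 0) bil0l addr0 => <-.
rewrite -[X in col_mx x X](addrK (gainK A B S R P *m x)).
by apply: lt_le_trans (bnd _ _); rewrite mulr_gt0 ?divr_gt0 // Dgt0.
Qed.

Theorem theorem4p8 (F : realType) (nx nu : nat)
    (A : 'M[F]_nx) (B : 'M[F]_(nx, nu))
    (Q : 'M[F]_nx) (S : 'M[F]_(nu, nx)) (R : 'M[F]_nu)
    (hAB : controllable A B)
    (hH : (block_mx Q S^T S R)^T = block_mx Q S^T S R) :
  [/\ condI A B Q S R \/ condII A B Q S R ->
      exists P : 'M[F]_nx,
        [/\ P^T = P,
            cgdare A B Q S R P,
            schur_stable (A - B *m gainK A B S R P),
            exp_stable (A - B *m gainK A B S R P) (B *m gainG B R P) &
            B *m gainG B R P = 0],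
      forall P : 'M[F]_nx,
        P^T = P ->
        cgdare A B Q S R P ->
        psdmx (Rm B R P) ->
        exp_stable (A - B *m gainK A B S R P) (B *m gainG B R P) ->
        condI A B Q S R /\ condII A B Q S R &
      condI A B Q S R <-> condII A B Q S R].
Proof.
(* [R_P >= 0] is recorded because the equivalence of (I) and (II) feeds this [P] to the converse. *)
have forward : condI A B Q S R \/ condII A B Q S R ->
    exists P, [/\ P^T = P, cgdare A B Q S R P, psdmx (Rm B R P) &
      [/\ schur_stable (A - B *m gainK A B S R P),
        exp_stable (A - B *m gainK A B S R P) (B *m gainG B R P) &
        B *m gainG B R P = 0]].
  case=> [[L1 [L2 [[L1sym L2sym] L1H L2H [_ L12]]]]|[L [Lsym LH Lres]]].
    have [P [Psym care PH LP]] := cgdare_above hAB hH L1sym L1H.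
    exists P; split=> //; first exact: psdmx_block_dr PH.
    apply: (cgdare_stabilizing hAB hH Psym L2sym care PH L2H).
    (* [P >= L1 > L2]. *)
    split=> [|x x0]; first by rewrite linearB /= Psym L2sym.
    have := L12 x x0; have := LP x.
    by rewrite !(quadform_bil (_ - _)) !bilB -!quadform_bil; lra.
  have [P [Psym care PH LP]] := cgdare_above hAB hH Lsym LH.
  exists P; split=> //; first exact: psdmx_block_dr PH.
  apply: (cgdare_stabilizing hAB hH Psym Lsym care PH LH).
  by apply: (condII_gap hH Psym Lsym care PH LH _ LP); rewrite /residual mulmxA.
have backward P := @exp_stable_conds F nx nu A B Q S R P hH.
split=> //.
  by move=> /forward[P [? ? _ [? ? ?]]]; exists P; split.
split=> [cI|cII].
  by have [P [? ? ? [_ ? _]]] := forward (or_introl cI); have [] := backward P.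
by have [P [? ? ? [_ ? _]]] := forward (or_intror cII); have [] := backward P.
Qed.
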